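(* Let $G=\{\mathbf u\in\mathbb R^N:\ g_i(\mathbf u)\succ 0,\ 1\le i\le I\}$ be convex with $\mathrm{int}(G)\neq\emptyset$, suppose that the boundary of $G$ is piecewise $C^1$ (in the sense specified in the context, with $C^1$ pieces $\mathcal S_i$), and that, when $\mathbb I\neq\emptyset$, $$G\cap\Big(\bigcup_{\mathbf u_*\in\mathcal S_i}\{\mathbf u\in\mathbb R^N:\ (\mathbf u-\mathbf u_* )\cdot\mathbf n_{i*}=0\}\Big)=\emptyset\qquad\forall\, i\in\mathbb I ,$$ where $\mathbf n_{i*}$ is an inward-pointing normal vector of $\mathcal S_i$ at $\mathbf u_*$. Assume further that $$\nabla g_i(\mathbf u_* )\neq\mathbf 0\qquad\forall\,\mathbf u_*\in\mathcal S_i,\ 1\le i\le I .$$ Then $G=G_*$, where $$G_*=\Big\{\mathbf u\in\mathbb R^N:\ \varphi_i(\mathbf u;\mathbf u_* )\succ 0\quad\forall\,\mathbf u_*\in\mathcal S_i,\ 1\le i\le I\Big\},\qquad \varphi_i(\mathbf u;\mathbf u_* ):=(\mathbf u-\mathbf u_* )\cdot\nabla g_i(\mathbf u_* ),$$ and each $\varphi_i$ is linear (affine) with respect to $\mathbf u$.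
   Context: The index set $\{1,\dots,I\}$ is the disjoint union of $\mathbb I$ and $\widehat{\mathbb I}$; in the $i$-th constraint (of $G$ and of $G_*$) ''$\succ$'' means ''$>$'' if $i\in\mathbb I$ and ''$\ge$'' if $i\in\widehat{\mathbb I}$. The functions $g_i$ are not assumed concave, and $G$ need be neither open nor closed. Let $G_i:=\{\mathbf u\in\mathbb R^N:\ g_i(\mathbf u)\succ 0\}$ and $\mathcal S_i:=\partial G\cap\partial G_i$. ''The boundary of $G$ is piecewise $C^1$'' means: $\partial G=\bigcup_{1\le i\le I}\mathcal S_i$, each $\mathcal S_i$ is a $C^1$ hypersurface in $\mathbb R^N$, and for each $i$ the function $g_i$ is $C^1$ at all points of $\mathcal S_i$. It is the paper's standing setting that the sets $G_i=\{g_i>0\}$ are open for $i\in\mathbb I$ and $G_i=\{g_i\ge 0\}$ are closed for $i\in\widehat{\mathbb I}$. A normal vector of $\mathcal S_i$ is a nonzero vector orthogonal to its tangent space; it is inward-pointing if it points towards the side of $G$. *)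

(* Defs.v *)
From HB Require Import structures.
From mathcomp Require Import all_boot all_order all_algebra.
From mathcomp Require Import all_classical all_reals all_analysis.

Set Implicit Arguments.
Unset Strict Implicit.
Unset Printing Implicit Defensive.

Import Order.TTheory GRing.Theory Num.Theory.
Import numFieldNormedType.Exports.
Local Open Scope classical_set_scope.
Local Open Scope ring_scope.

Definition boundary (T : topologicalType) (A : set T) : set T :=
  closure A `\` interior A.

Section EuclideanSpace.
Context {R : realType} {N : nat}.
Local Notation V := 'rV[R]_N.
Implicit Types (f h : V -> R) (S G : set V) (p u v n d : V).

Definition dot u v : R := \sum_(k < N) u ord0 k * v ord0 k.

Definition gradient f p : V := \row_(k < N) 'D_(delta_mx ord0 k) f p.

(* Only continuity of the gradient at p itself is required, so that this is
   implied by f being C^1 on some neighbourhood of p. *)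
Definition C1_at f p : Prop :=
  (\forall q \near p, differentiable f q) /\
  {for p, continuous (gradient f)}.

Definition rel_interior S h : set V :=
  [set r | S r /\ \forall s \near r, h s = 0 -> S s].

(* Near p, the set S lies on the regular level set {h = 0} of a C^1 function h,
   and p is a limit of points around which S is the whole level set. If p is
   itself such a point, then S is a C^1 submanifold of codimension 1 near p.
   Otherwise p belongs to the edge of S: this is needed because the smooth
   pieces of a boundary (e.g. the closed facets of a polytope) have edges. *)
Definition local_equation S p h : Prop :=
  [/\ \forall q \near p, C1_at h q,
      gradient h p <> 0,
      \forall q \near p, S q -> h q = 0
    & closure (rel_interior S h) p].

Definition C1_hypersurface S : Prop :=
  forall p, S p -> exists h, local_equation S p h.

(* The tangent space is the kernel of the differential of a local equation;
   it does not depend on the choice of that equation: two level sets as above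
   agree near points of S tending to p, and gradients are continuous. *)
Definition tangent_space S p : set V :=
  [set v | exists2 h, local_equation S p h & dot v (gradient h p) = 0].

Definition normal_vector S p n : Prop :=
  n <> 0 /\ forall v, tangent_space S p v -> dot n v = 0.

(* n points to the side of the tangent hyperplane from which G is entered. At a
   point of the edge of S, p + t n itself may be outside G for all t > 0, hence
   the comparison with a direction d pointing into G. *)
Definition inward_pointing G p n : Prop :=
  exists2 d, (\forall t \near 0^'+, interior G (p + t *: d)) & 0 < dot n d.

End EuclideanSpace.

Section ConstrainedRegion.
Context {R : realType} {N I : nat}.
Local Notation V := 'rV[R]_N.
(* The i-th constraint is g i u > 0 if i \in strict, and g i u >= 0 otherwise *)
Variables (g : 'I_I -> V -> R) (strict : {set 'I_I}).

Definition succ0 (i : 'I_I) (x : R) : bool := 0 < x ?<= if (i \notin strict).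

Definition constraint_set (i : 'I_I) : set V := [set u | succ0 i (g i u)].

Definition region : set V := [set u | forall i, succ0 i (g i u)].

Definition piece (i : 'I_I) : set V :=
  boundary region `&` boundary (constraint_set i).

Definition piecewise_C1_boundary : Prop :=
  [/\ boundary region = \bigcup_(i in [set: 'I_I]) piece i,
      forall i, C1_hypersurface (piece i)
    & forall i us, piece i us -> C1_at (g i) us].

Definition phi (i : 'I_I) (u us : V) : R := dot (u - us) (gradient (g i) us).

Definition region_star : set V :=
  [set u | forall i us, piece i us -> succ0 i (phi i u us)].

End ConstrainedRegion.

(* Main.v *)
Require Import Defs.
From HB Require Import structures.
From mathcomp Require Import all_boot all_order all_algebra.
From mathcomp Require Import all_classical all_reals all_analysis.
From mathcomp Require Import ring lra.
Import Order.TTheory GRing.Theory Num.Theory.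
Import numFieldNormedType.Exports.
Local Open Scope classical_set_scope.
Local Open Scope ring_scope.

(** Why the theorem is true.  Write S_i for the i-th smooth piece of the
    boundary of the convex set G.

    - G is contained in G_*.  Let p be a point of S_i.  By convexity the
      segment from p to an interior point w of G runs inside G
      ([convex_closure_interior]), so g_i is nonnegative along it, and g_i
      vanishes at p; hence its derivative at p towards w, which is phi_i(w; p),
      is nonnegative.  Being nonconstant and affine, phi_i(.; p) is then
      positive on the open set int G ([phi_gt0_interior]) and nonnegative on G
      ([phi_ge0]).  For a nonstrict constraint this is what is wanted.  For a
      strict one, phi_i(u; p) <> 0 remains to be shown for u in G; the
      hypothesis says that (u - p) . n_i <> 0, so it suffices that n_i is
      parallel to the gradient of g_i at p ([normal_vector_tangent]).

    - The normal direction.  The tangent space is defined by a local equation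
      h = 0 of S_i, and g_i vanishes on S_i.  Around suitable points r of S_i
      arbitrarily close to p, the set S_i is the whole level set of h, and
      there the differential of g_i vanishes on the kernel of that of h, by the
      intermediate value theorem ([diff_eq0_on_zero_set]).  So the two gradients
      are parallel at r, and by continuity at p.

    - G_* is contained in G.  Let u be outside G and w interior to G.  If u is
      not in the closure of G, the segment from w to u crosses the boundary at
      some p <> u, which belongs to a piece S_i; the affine function
      phi_i(.; p) is positive at w and zero at p, hence negative at u
      ([phi_neg_outside]).  If u is in the closure, it violates some
      constraint, which must be a strict one as the other sets G_i are closed;
      then u itself belongs to S_i, and phi_i(u; u) = 0
      ([boundary_outside]). *)

Set Implicit Arguments.
Unset Strict Implicit.

(** * The dot product and the gradient *)

Section Dot.
Context {R : realType} {N : nat}.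
Local Notation V := 'rV[R]_N.
Implicit Types (f : V -> R) (a b p u v w : V).

Lemma dotC u v : dot u v = dot v u.
Proof. by apply: eq_bigr => k _; rewrite mulrC. Qed.

Lemma dotDl u v w : dot (u + v) w = dot u w + dot v w.
Proof. by rewrite -big_split; apply: eq_bigr => k _; rewrite mxE mulrDl. Qed.

Lemma dotZl (c : R) u v : dot (c *: u) v = c * dot u v.
Proof. by rewrite /dot mulr_sumr; apply: eq_bigr => k _; rewrite mxE mulrA. Qed.

Lemma dotBl u v w : dot (u - v) w = dot u w - dot v w.
Proof. by rewrite -scaleN1r dotDl dotZl mulN1r. Qed.

Lemma dotZr (c : R) u v : dot u (c *: v) = c * dot u v.
Proof. by rewrite dotC dotZl dotC. Qed.

Lemma dotvv_ge0 u : 0 <= dot u u.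
Proof. by apply: sumr_ge0 => k _; rewrite -expr2 sqr_ge0. Qed.

Lemma dotvv_eq0 u : (dot u u == 0) = (u == 0).
Proof.
apply/idP/eqP => [|->]; last by rewrite /dot big1 // => k _; rewrite mxE mul0r.
rewrite /dot psumr_eq0 => [/allP u0|k _]; last by rewrite -expr2 sqr_ge0.
apply/rowP => k; rewrite mxE; apply/eqP.
by have := u0 k (mem_index_enum _); rewrite mulf_eq0 orbb.
Qed.

Lemma dotvv_gt0 u : u <> 0 -> 0 < dot u u.
Proof. by move=> /eqP u0; rewrite lt_def dotvv_eq0 u0 dotvv_ge0. Qed.

(** An algebraic form of `a is a multiple of b', which makes sense for b = 0 and
    survives passing to the limit. *)
Lemma dot_ker_colinear a b : (forall v, dot v b = 0 -> dot v a = 0) ->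
  dot b b *: a = dot a b *: b.
Proof.
(* d lies in the kernel of b, hence is orthogonal to itself *)
move=> ker; set d := dot b b *: a - dot a b *: b.
have db : dot d b = 0 by rewrite dotBl !dotZl mulrC subrr.
apply/eqP; rewrite -subr_eq0 -/d -dotvv_eq0.
rewrite {1}/d dotBl !dotZl (dotC a) (dotC b) db ker //.
by rewrite !mulr0 subrr.
Qed.

Lemma dot_continuous (T : topologicalType) (s t : T -> V) (x : T) :
  {for x, continuous s} -> {for x, continuous t} ->
  {for x, continuous (fun y => dot (s y) (t y))}.
Proof.
move=> sc tc.
have coord k (r : T -> V) : {for x, continuous r} ->
    (fun y => r y ord0 k) @ x --> r x ord0 k.
  move=> rc; apply: (@cvg_comp _ _ _ r (fun M : V => M ord0 k)) rc _.
  exact: coord_continuous.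
apply: (@cvg_big); first exact: add_continuous.
by move=> k _; apply: cvgM; apply: coord.
Qed.

Lemma diff_gradient f p v :
  differentiable f p -> 'd f p v = dot v (gradient f p).
Proof.
move=> df; rewrite {1}(row_sum_delta v) linear_sum; apply: eq_bigr => k _.
by rewrite linearZ /= mxE deriveE.
Qed.

End Dot.

(** * Convex sets with interior points *)

Section Convex.
Context {R : realType} {V : normedModType R}.
Implicit Types (G : set V) (p u v w x y : V).

Lemma segmentE x y (t : R) : x + t *: (y - x) = (1 - t) *: x + t *: y.
Proof. by rewrite scalerBr scalerBl scale1r addrCA addrC. Qed.

Lemma convex_segment G x y (t : R) : @convex_set R V G ->
  G x -> G y -> 0 <= t -> t <= 1 -> G ((1 - t) *: x + t *: y).
Proof.
move=> cG Gx Gy t0 t1.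
have [s0 s1] : 0 <= 1 - t /\ 1 - t <= 1.
  by rewrite subr_ge0 t1 lerBlDr lerDl t0.
have := cG x y (Itv01 s0 s1); rewrite !inE => /(_ Gx Gy); congr (G _).
transitivity ((1 - t) *: x + (1 - (1 - t)) *: y); first by [].
by rewrite opprB addrCA subrr addr0.
Qed.

Lemma homothety_cvg (c : R) x y p :
  (fun q : V => x + c *: (q - y)) @ p --> x + c *: (p - y).
Proof.
apply: cvgD; first exact: cvg_cst.
apply: cvgZ; first exact: cvg_cst.
by apply: cvgB; [exact: cvg_id|exact: cvg_cst].
Qed.

Lemma line_continuous x v : continuous (fun t : R => x + t *: v).
Proof.
move=> t; apply: cvgD; first exact: cvg_cst.
by apply: cvgZ; [exact: cvg_id|exact: cvg_cst].
Qed.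

(** If p is in the closure and w' interior, replace p by a nearby point q of G
    and move w' slightly, to the point from which the segment to q still passes
    through p + t (w' - p); so that point is in G ([ray]).  Letting w' range over
    a neighbourhood of w gives a neighbourhood of p + t (w - p). *)
Lemma convex_closure_interior G p w (t : R) :
  @convex_set R V G -> closure G p -> interior G w -> 0 < t -> t <= 1 ->
  interior G (p + t *: (w - p)).
Proof.
move=> cG clp Gw t0 t1; have tn0 : t != 0 by rewrite gt_eqF.
have ray w' : interior G w' -> G (p + t *: (w' - p)).
  move=> Gw'.
  pose F q : V := w' + (- ((1 - t) / t)) *: (q - p).
  have Fc : F @ p --> w'.
    have := @homothety_cvg (- ((1 - t) / t)) w' p p.
    by rewrite subrr scaler0 addr0.
  have [q [Gq GF]] := clp _ (Fc _ Gw').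
  have := @convex_segment _ _ _ t cG Gq GF (ltW t0) t1; congr (G _).
  rewrite segmentE /F scalerDr scalerA mulrN mulrC divfK // scaleNr.
  by rewrite addrCA -scalerBr opprB addrCA subrr addr0 addrC.
have Fc : (fun x => p + t^-1 *: (x - p)) @ (p + t *: (w - p)) --> w.
  rewrite [X in _ --> X](_ : w = p + t^-1 *: (p + t *: (w - p) - p)).
    exact: homothety_cvg.
  by rewrite addrAC subrr add0r scalerA mulVf // scale1r addrC subrK.
have nearw : \forall x \near p + t *: (w - p),
    interior G (p + t^-1 *: (x - p)).
  exact: Fc (open_nbhs_nbhs (conj (open_interior G) Gw)).
change (\forall x \near p + t *: (w - p), G x).
near=> x.
have /ray : interior G (p + t^-1 *: (x - p)) by near: x.
congr (G _).
by rewrite addrAC subrr add0r scalerA mulfV // scale1r addrC subrK.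
Unshelve. all: by end_near. Qed.

(** Otherwise the interior and the closure of G would have the same trace on
    the segment, which would be open and closed in it, contradicting
    connectedness. *)
Lemma segment_meets_boundary G w u : interior G w -> ~ interior G u ->
  exists2 t : R, 0 <= t <= 1 & boundary G (w + t *: (u - w)).
Proof.
move=> Gw Gu; apply: contrapT => nobd.
pose l (t : R) := w + t *: (u - w).
have lc : continuous l by exact: line_continuous.
pose B := `[0 : R, 1] `&` l @^-1` interior G.
have BE : B = [set` `[0, 1]] `&` l @^-1` closure G.
  apply/seteqP; split => t [t01 lt]; split => //.
    by apply: subset_closure; exact: interior_subset.
  apply: contrapT => nlt; apply: nobd; exists t; last by split.
  by move: t01; rewrite /= in_itv.
have B01 : B = [set` `[0, 1]].
  apply: (@segment_connected R 0 1).
  - exists 0; split; first by rewrite /= in_itv /= lexx ler01.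
    by rewrite /l /= scale0r addr0.
  - exists (l @^-1` interior G) => //.
    by apply: open_comp; [move=> t _; exact: lc|exact: open_interior].
  - exists (l @^-1` closure G) => //.
    by apply: closed_comp => [t _|]; [exact: lc|exact: closed_closure].
have : B 1 by rewrite B01 /= in_itv /= ler01 lexx.
by move=> [_]; rewrite /l /= scale1r addrC subrK.
Qed.
End Convex.

(** * Differentials of real-valued functions *)

Section Differential.
Context {R : realType} {V : normedModType R}.
Implicit Types (f g h : V -> R) (p v w : V).

Lemma diff_estimate f p (e : R) : differentiable f p -> 0 < e ->
  \forall x \near p, `|f x - f p - 'd f p (x - p)| <= e * `|x - p|.
Proof.
move=> df e0; have /eqaddoP/(_ e e0) := diff_locally df.
rewrite [\forall x \near p, _](near_shift 0) subr0; apply: filterS => x /=.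
by rewrite /shift /= addrK opprD addrA.
Qed.

Lemma diff_ge0 f p v : differentiable f p -> f p = 0 ->
  (forall t : R, 0 < t -> t <= 1 -> 0 <= f (p + t *: v)) -> 0 <= 'd f p v.
Proof.
move=> df fp0 fray; rewrite leNgt; apply/negP => dlt0.
set d := 'd f p v in dlt0.
have e0 : 0 < - d / (2 * (`|v| + 1)).
  by rewrite divr_gt0 ?oppr_gt0 // mulr_gt0 // ltr_wpDl.
have /nbhs_normP[r /= r0 est] := diff_estimate df e0.
pose t := Num.min 1 (r / (2 * (`|v| + 1))).
have v0 : 0 <= `|v| by [].
have v1 : 0 < `|v| + 1 by rewrite ltr_wpDl.
have t0 : 0 < t by rewrite lt_min ltr01 divr_gt0 // mulr_gt0.
have t1 : t <= 1 by rewrite ge_min lexx.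
have trv : t * `|v| < r.
  have : t <= r / (2 * (`|v| + 1)) by rewrite ge_min lexx orbT.
  rewrite ler_pdivlMr ?mulr_gt0 //; nra.
have := est (p + t *: v); rewrite /ball_ /=.
rewrite opprD addNKr normrN normrZ gtr0_norm // => /(_ trv).
rewrite [p + _ - p]addrAC subrr add0r linearZ /= -/d fp0 subr0.
rewrite normrZ gtr0_norm //.
have := fray t t0 t1; set y := f _ => y0 yle.
have : y - t * d <= - d / (2 * (`|v| + 1)) * (t * `|v|).
  by apply: le_trans yle; exact: ler_norm.
rewrite mulrAC ler_pdivlMr ?mulr_gt0 //.
have : 0 < t * (- d) by rewrite mulr_gt0 // oppr_gt0.
nra.
Qed.

(** In the plane through p spanned by v and w, the function h behaves near p
    like the w-coordinate.  So for small t > 0 it changes sign along the short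
    segment of points p + t (v + s w), |s| <= del, and vanishes for some s.
    There g vanishes as well, so that the derivative a + s b of g in the
    direction v + s w is almost 0; as del is arbitrary, a = 0. *)
Lemma diff_eq0_on_zero_set g h p v w :
  differentiable g p -> differentiable h p ->
  (\forall x \near p, {for x, continuous h}) -> h p = 0 ->
  (\forall x \near p, h x = 0 -> g x = 0) ->
  'd h p w = 1 -> 'd h p v = 0 -> 'd g p v = 0.
Proof.
move=> dg dh hc hp0 hg hw hv; apply: contrapT => /eqP a0.
have gp0 : g p = 0 by exact: (nbhs_singleton hg).
set a := 'd g p v in a0; pose b := 'd g p w.
have na : 0 < `|a| by rewrite normr_gt0.
have nb : 0 <= `|b| by [].
have nb1 : 0 < `|b| + 1 by rewrite ltr_wpDl.
(* del makes |s b| at most |a| / 2; M bounds |v + s w|; e makes the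
   first-order errors, divided by t, less than del for h and |a| / 2 for g *)
pose del := `|a| / (2 * (`|b| + 1)).
have del0 : 0 < del by rewrite divr_gt0 // mulr_gt0.
have delb : del * `|b| <= `|a| / 2.
  rewrite /del mulrAC ler_pdivrMr ?mulr_gt0 //; nra.
pose M := `|v| + del * `|w| + 1.
have M0 : 0 < M by rewrite ltr_wpDl // addr_ge0 // mulr_ge0 // ltW.
pose e := Num.min del (`|a| / 2) / (2 * M).
have m0 : 0 < Num.min del (`|a| / 2) by rewrite lt_min del0 divr_gt0.
have e0 : 0 < e by rewrite divr_gt0 // mulr_gt0.
have eM : e * M < Num.min del (`|a| / 2).
  by rewrite /e invfM mulrA mulrVK ?unitfE ?gt_eqF// ltr_pdivrMr //; lra.
have [eMd eMa] : e * M < del /\ e * M < `|a| / 2.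
  by move: eM; rewrite lt_min => /andP[].
have /nbhs_normP[r /= r0 near_p] : \forall x \near p,
    [/\ `|g x - g p - 'd g p (x - p)| <= e * `|x - p|,
        `|h x - h p - 'd h p (x - p)| <= e * `|x - p|,
        {for x, continuous h} & h x = 0 -> g x = 0].
  near=> x; split; near: x => //; exact: diff_estimate.
pose t := r / (2 * M).
have t0 : 0 < t by rewrite divr_gt0 // mulr_gt0.
have tM : t * M < r.
  by rewrite /t invfM mulrA mulrVK ?unitfE ?gt_eqF// ltr_pdivrMr //; lra.
pose x s := p + t *: (v + s *: w).
have xp s : x s - p = t *: (v + s *: w) by rewrite /x addrAC subrr add0r.
have xpM s : `|s| <= del -> `|x s - p| <= t * M.
  move=> sd; rewrite xp normrZ gtr0_norm // ler_pM2l //.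
  apply: le_trans (ler_normD _ _) _; rewrite normrZ /M -addrA lerD2l.
  by rewrite ler_wpDr // ler_wpM2r.
have xnear s : `|s| <= del -> [/\ `|g (x s) - t * (a + s * b)| <= t * (e * M),
    `|h (x s) - t * s| <= t * (e * M), {for x s, continuous h}
    & h (x s) = 0 -> g (x s) = 0].
  move=> sd; have xM := xpM s sd.
  have [] := near_p (x s); first by rewrite /ball_ /= distrC (le_lt_trans xM).
  have eM' : e * `|x s - p| <= t * (e * M) by rewrite mulrCA ler_wpM2l // ltW.
  have dgE : 'd g p (x s - p) = t * (a + s * b).
    by rewrite xp linearZ linearD linearZ.
  have dhE : 'd h p (x s - p) = t * s.
    by rewrite xp linearZ linearD linearZ /= hv hw add0r /GRing.scale /= mulr1.
  rewrite gp0 hp0 !subr0 dgE dhE => ge he ? ?.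
  by split=> //; [exact: le_trans ge eM'|exact: le_trans he eM'].
have teM : t * (e * M) < t * del by rewrite ltr_pM2l.
have [s sI hxs] : exists2 s, s \in `[- del, del] & h (x s) = 0.
  have dd : - del <= del by lra.
  apply: IVT => //; last first.
    have [|_ h1 _ _] := xnear (- del); first by rewrite normrN gtr0_norm.
    have [|_ h2 _ _] := xnear del; first by rewrite gtr0_norm.
    rewrite ge_min le_max.
    move: h1 h2; rewrite !ler_norml => /andP[h1 h1'] /andP[h2 h2'].
    by apply/andP; split; apply/orP; [left|right]; lra.
  apply: continuous_in_subspaceT => s; rewrite inE /= in_itv /= => sI.
  have [|_ _ hcs _] := xnear s; first by rewrite ler_norml.
  apply: continuous_comp; last exact: hcs.
  apply: cvgD; first exact: cvg_cst.
  apply: cvgZ; first exact: cvg_cst.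
  apply: cvgD; first exact: cvg_cst.
  by apply: cvgZ; [exact: cvg_id|exact: cvg_cst].
have sd : `|s| <= del by move: sI; rewrite in_itv /= ler_norml.
have [gs _ _ /(_ hxs) gxs] := xnear s sd.
move: gs; rewrite gxs sub0r normrN normrM gtr0_norm // ler_pM2l // => abM.
have : `|a| <= `|a + s * b| + `|s * b|.
  by rewrite -{1}(addrK (s * b) a) ler_normB.
have : `|s * b| <= del * `|b| by rewrite normrM ler_wpM2r.
lra.
Unshelve. all: by end_near. Qed.
End Differential.

(** * Normal vectors and defining functions of hypersurfaces *)

Section LocalEquation.
Context {R : realType} {N : nat}.
Local Notation V := 'rV[R]_N.
Implicit Types (g h : V -> R) (S : set V) (p v n : V).

Lemma gradient_colinear_regular g h p :
  differentiable g p -> C1_at h p -> h p = 0 ->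
  (\forall q \near p, h q = 0 -> g q = 0) ->
  dot (gradient h p) (gradient h p) *: gradient g p =
  dot (gradient g p) (gradient h p) *: gradient h p.
Proof.
move=> dg [dh _] hp0 hg; have dhp := nbhs_singleton dh.
set b := gradient h p; have [->|b0] := eqVneq b 0.
  rewrite scaler0 (_ : dot 0 0 = 0) ?scale0r //.
  by apply/eqP; rewrite dotvv_eq0.
apply: dot_ker_colinear => v vb.
rewrite -diff_gradient //.
(* the transversal direction is the gradient b of h, scaled to have slope 1 *)
apply: (@diff_eq0_on_zero_set _ _ g h p v ((dot b b)^-1 *: b)) => //.
- by near=> q; apply: differentiable_continuous; near: q.
- by rewrite diff_gradient // dotZl mulVf // dotvv_eq0.
- by rewrite diff_gradient.
Unshelve. all: by end_near. Qed.

(** At p itself S need not be the whole level set of h, so the two gradients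
    are compared at nearby points where it is.  The identity is paired with a
    fixed v so that its defect D is a real function, continuous at p. *)
Lemma gradient_colinear_local_equation g h S p v :
  C1_at g p -> (forall q, S q -> g q = 0) -> local_equation S p h ->
  dot (gradient h p) (gradient h p) * dot v (gradient g p) =
  dot (gradient g p) (gradient h p) * dot v (gradient h p).
Proof.
move=> [dg cg] Sg [hC1 _ Sh clp].
pose D q := dot (gradient h q) (gradient h q) * dot v (gradient g q) -
            dot (gradient g q) (gradient h q) * dot v (gradient h q).
have [_ ch] := nbhs_singleton hC1.
have Dc : D @ p --> D p.
  have cv : {for p, continuous (fun=> v)} by exact: cst_continuous.
  exact: cvgB (cvgM (dot_continuous ch ch) (dot_continuous cv cg))
              (cvgM (dot_continuous cg ch) (dot_continuous cv ch)).
apply/eqP; rewrite -subr_eq0; apply/eqP; apply: contrapT => /eqP Dp0.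
have Dn0 : \forall q \near p, D q != 0.
  have n0 : nbhs (D p) [set x | x != 0].
    exact: open_nbhs_nbhs (conj (@open_neq R 0) Dp0).
  exact: (Dc _ n0).
have near_p : \forall q \near p,
    [/\ D q != 0, C1_at h q, S q -> h q = 0 & differentiable g q].
  by near=> q; split; near: q.
have [r [[Sr hS] [/negP Dr0 hr Shr dgr]]] := clp _ near_p.
apply: Dr0; rewrite subr_eq0 -!dotZr.
rewrite (@gradient_colinear_regular g h r) //; first exact: Shr.
by apply: filterS hS => s /[apply]; exact: Sg.
Unshelve. all: by end_near. Qed.

(** A vector orthogonal to the gradient of g is tangent to S, because that
    gradient and the one of a local equation of S are nonzero multiples of each
    other. *)
Lemma normal_vector_tangent g S p n u :
  C1_hypersurface S -> S p -> C1_at g p -> (forall q, S q -> g q = 0) ->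
  gradient g p <> 0 -> normal_vector S p n ->
  dot u (gradient g p) = 0 -> dot u n = 0.
Proof.
move=> /[swap] Sp /(_ _ Sp) [h hS] gC1 Sg a0 [_ nT] ua.
have colin v := @gradient_colinear_local_equation g h S p v gC1 Sg hS.
set a := gradient g p in a0 ua colin; set b := gradient h p in colin.
have ab0 : dot a b != 0.
  apply/eqP => ab; have := colin a; rewrite ab mul0r => /eqP.
  rewrite mulf_eq0 !dotvv_eq0; case/orP => /eqP //.
  by case: hS.
rewrite dotC; apply: nT; exists h => //.
by apply: (mulfI ab0); rewrite -colin ua !mulr0.
Qed.
End LocalEquation.

(** * The linear forms phi on the convex region *)

Section Region.
Context {R : realType} {N I : nat}.
Local Notation V := 'rV[R]_N.
Variables (g : 'I_I -> V -> R) (strict : {set 'I_I}).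
Local Notation G := (region g strict).
Local Notation S := (piece g strict).

Lemma succ0W i (x : R) : succ0 strict i x -> 0 <= x.
Proof. by rewrite /succ0; case: (i \notin strict) => //=; exact: ltW. Qed.

Lemma succ0_gt0 i (x : R) : 0 < x -> succ0 strict i x.
Proof. by rewrite /succ0; case: (i \notin strict) => //=; exact: ltW. Qed.

(** By continuity, g i > 0 would make p interior to the i-th constraint set and
    g i < 0 would make it exterior. *)
Lemma piece_eq0 i p : {for p, continuous (g i)} -> S i p -> g i p = 0.
Proof.
move=> gc [_ [clp nint]].
apply/eqP; rewrite eq_le; apply/andP; split; rewrite leNgt; apply/negP => gp.
  apply: nint; have : \forall q \near p, 0 < g i q.
    have n0 : nbhs (g i p) [set x | 0 < x].
      exact: open_nbhs_nbhs (conj (@open_gt R 0) gp).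
    exact: (gc _ n0).
  by apply: filterS => q; exact: succ0_gt0.
have : \forall q \near p, g i q < 0.
  have n0 : nbhs (g i p) [set x | x < 0].
    exact: open_nbhs_nbhs (conj (@open_lt R 0) gp).
  exact: (gc _ n0).
by move=> /clp [q [Gq gq]]; have := succ0W Gq; rewrite leNgt gq.
Qed.

Hypothesis hconvex : @convex_set R V G.

(** Nonnegativity comes from the derivative of g i along segments issued from p;
    if the value at w were 0, moving w slightly against the gradient would make
    it negative. *)
Lemma phi_gt0_interior i p w : C1_at (g i) p -> gradient (g i) p <> 0 ->
  S i p -> interior G w -> 0 < phi g i w p.
Proof.
move=> [dg _] a0 Sp Gw; have dgp := nbhs_singleton dg.
have gp0 := piece_eq0 (differentiable_continuous dgp) Sp.
have ge0 w' : interior G w' -> 0 <= phi g i w' p.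
  move=> Gw'; rewrite /phi -diff_gradient //; apply: diff_ge0 => // t t0 t1.
  have := interior_subset (convex_closure_interior hconvex Sp.1.1 Gw' t0 t1).
  by move=> /(_ i) /succ0W.
set a := gradient (g i) p in a0.
have [t [t0 Gt]] : exists t, 0 < t /\ interior G (w + (- t) *: a).
  have : \forall t \near (0 : R), interior G (w + t *: (- a)).
    have := @line_continuous R V w (- a) 0.
    rewrite /continuous_at scale0r addr0 => lc.
    exact: (lc _ (open_nbhs_nbhs (conj (open_interior G) Gw))).
  move=> /nbhs_normP[r /= r0 nr]; exists (r / 2).
  split; first by rewrite divr_gt0.
  rewrite scaleNr -scalerN; apply: nr; rewrite /ball_ /= sub0r normrN gtr0_norm.
    lra.
  by rewrite divr_gt0.
have ta : 0 < t * dot a a by rewrite mulr_gt0 // dotvv_gt0.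
have := ge0 _ Gt; rewrite /phi -/a !dotBl dotDl dotZl mulNr; lra.
Qed.

Lemma phi_affine i p w u (t : R) :
  phi g i (w + t *: (u - w)) p = (1 - t) * phi g i w p + t * phi g i u p.
Proof. by rewrite /phi !dotBl dotDl dotZl dotBl; ring. Qed.

Lemma phi_base i p : phi g i p p = 0.
Proof. by rewrite /phi subrr -(scale0r p) dotZl mul0r. Qed.

Hypothesis hint : interior G !=set0.
Hypothesis hC1 : piecewise_C1_boundary g strict.
Hypothesis hgrad : forall i p, S i p -> gradient (g i) p <> 0.

(** On the segment from u to an interior point, phi is affine, and positive
    except perhaps at u. *)
Lemma phi_ge0 i p u : S i p -> G u -> 0 <= phi g i u p.
Proof.
move=> Sp Gu; have [_ _ /(_ _ _ Sp) gC1] := hC1.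
have [w Gw] := hint.
have pos x : interior G x -> 0 < phi g i x p.
  exact: phi_gt0_interior gC1 (hgrad Sp) Sp.
have wpos := pos w Gw.
rewrite leNgt; apply/negP => upos.
set a := phi g i u p in upos; set b := phi g i w p in wpos.
have ba : 0 < b - a by lra.
(* if phi were negative at u, it would vanish at this time t in (0, 1] *)
have t0 : 0 < - a / (b - a) by rewrite divr_gt0 // oppr_gt0.
have t1 : - a / (b - a) <= 1 by rewrite ler_pdivrMr //; lra.
have := pos _ (convex_closure_interior hconvex (subset_closure Gu) Gw t0 t1).
rewrite phi_affine -/a -/b (_ : _ + _ = 0) ?ltxx //; field.
by rewrite gt_eqF.
Qed.

(** The tangent hyperplane at a point where the segment from an interior point
    to u leaves G has that interior point strictly on one side, hence u strictly
    on the other. *)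
Lemma phi_neg_outside u : ~ closure G u ->
  exists i p, S i p /\ phi g i u p < 0.
Proof.
move=> nGu; have [w Gw] := hint; have [bdE _ gC1] := hC1.
have niGu : ~ interior G u by move=> /interior_subset/subset_closure.
have [t /andP[t0 t1] bdp] := segment_meets_boundary Gw niGu.
have := bdp; rewrite bdE => -[i _ Sp].
exists i, (w + t *: (u - w)); split=> //.
have := phi_gt0_interior (gC1 _ _ Sp) (hgrad Sp) Sp Gw.
have := phi_base i (w + t *: (u - w)); rewrite {1}phi_affine.
have tn1 : t != 1.
  apply: contra_notN nGu => /eqP t1E.
  by case: bdp; rewrite t1E scale1r addrC subrK.
have {}t1 : t < 1 by rewrite lt_neqAle tn1.
set a := phi g i w _; set b := phi g i u _; nra.
Qed.

(** The constraint that u violates has u in the closure of its set, which is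
    therefore not closed. *)
Lemma boundary_outside u : closure G u -> ~ G u ->
  (forall i, i \notin strict -> closed (constraint_set g strict i)) ->
  exists2 i, i \in strict & S i u.
Proof.
move=> clu nGu hcl.
have [i /negP gi] : exists i, ~ succ0 strict i (g i u).
  by apply/existsNP.
have cli : closure (constraint_set g strict i) u.
  by apply: closure_subset clu => x; apply.
exists i; last first.
  by split; split => // /interior_subset //; exact/negP.
apply: contraT => /hcl /closure_id cE; move: cli; rewrite -cE.
by rewrite /constraint_set /= (negbTE gi).
Qed.

End Region.

(** * Equality of the region and its linear description *)

Set Strict Implicit.
Unset Implicit Arguments.

Theorem theorem4p1 (R : realType) (N I : nat) (g : 'I_I -> 'rV[R]_N -> R)
  (strict : {set 'I_I}) (n : 'I_I -> 'rV[R]_N -> 'rV[R]_N)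
  (hopen : forall i, i \in strict -> open (constraint_set g strict i))
  (hclosed : forall i, i \notin strict -> closed (constraint_set g strict i))
  (hconvex : @convex_set R 'rV[R]_N (region g strict))
  (hint : interior (region g strict) !=set0)
  (hC1 : piecewise_C1_boundary g strict)
  (hn : forall i us, i \in strict -> piece g strict i us ->
     normal_vector (piece g strict i) us (n i us) /\
     inward_pointing (region g strict) us (n i us))
  (hmiss : forall i, i \in strict ->
     region g strict `&`
       \bigcup_(us in piece g strict i) [set u | dot (u - us) (n i us) = 0] = set0)
  (hgrad : forall i us, piece g strict i us -> gradient (g i) us <> 0) :
  region g strict = region_star g strict /\
  forall i us, piece g strict i us ->
    exists (l : {scalar 'rV[R]_N}) (c : R), forall u, phi g i u us = l u + c.

Proof.
have [_ hpC1 gC1] := hC1.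
split; last first.
  move=> i us _; set a := gradient (g i) us.
  have lin : scalar (dot^~ a) by move=> c u v; rewrite dotDl dotZl.
  pose l : {scalar 'rV[R]_N} :=
    HB.pack (dot^~ a) (GRing.isLinear.Build R 'rV[R]_N R _ (dot^~ a) lin).
  by exists l, (- dot us a) => u; rewrite /phi dotBl.
apply/seteqP; split => u.
  move=> Gu i p Sp; have phi0 := phi_ge0 hconvex hint hC1 hgrad Sp Gu.
  rewrite /succ0; have [si|si] /= := boolP (i \in strict); last exact: phi0.
  rewrite lt_neqAle eq_sym phi0 andbT; apply/eqP => phi_eq0.
  have [nv _] := hn i p si Sp.
  have : (region g strict `&` \bigcup_(us in piece g strict i)
    [set v | dot (v - us) (n i us) = 0]) u.
    split=> //; exists p => //=.
    have a0 := hgrad i p Sp.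
    apply: (normal_vector_tangent (hpC1 i) Sp (gC1 _ _ Sp) _ a0 nv) => //.
    move=> q Sq; apply: (piece_eq0 _ Sq).
    have [/nbhs_singleton dq _] := gC1 i q Sq.
    exact: differentiable_continuous.
  by rewrite hmiss.
move=> Gsu; apply: contrapT => nGu.
have [clu|nclu] := pselect (closure (region g strict) u).
  have [i si Sp] := boundary_outside clu nGu hclosed.
  by have := Gsu i u Sp; rewrite phi_base /succ0 si /= ltxx.
have [i [p [Sp philt]]] := phi_neg_outside hconvex hint hC1 hgrad nclu.
by have := succ0W (Gsu i p Sp); rewrite leNgt philt.
Qed.
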